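(* Let $X$ take values in $\{1,\dots,K\}$ with $p_x=P(X=x)>0$ for each $x$. Assume consistency $Y=Y_X$, conditional ignorability $(Y_1,\dots,Y_K)\perp X\mid \boldsymbol Z$, and positivity $0<P(X=x\mid \boldsymbol Z=\boldsymbol z)<1$ for all $x$ and all $\boldsymbol z$. Then $$\mathcal{MI}_X=\sum_{x=1}^{K}\sum_{x^*\neq x}p_x\,p_{x^*}\;\mathbb E_{\boldsymbol Z\mid X=x}\Big(\big[\mathbb E(Y_x\mid \boldsymbol Z)-\mathbb E(Y_{x^*}\mid \boldsymbol Z)\big]^2\Big),$$ where $\mathbb E_{\boldsymbol Z\mid X=x}$ denotes expectation over $\boldsymbol Z$ drawn from its conditional distribution given $X=x$.
   Context: Let $O=(Y,X,\boldsymbol Z)$ be a random vector with real outcome $Y$, $\mathbb E[Y^2]<\infty$, predictor/treatment $X$ and covariate vector $\boldsymbol Z$. Let $f_0(x,\boldsymbol z)=\mathbb E(Y\mid X=x,\boldsymbol Z=\boldsymbol z)$ be the true conditional expectation function. Let $O^{(a)}=(Y^{(a)},X^{(a)},\boldsymbol Z^{(a)})$ and $O^{(b)}=(Y^{(b)},X^{(b)},\boldsymbol Z^{(b)})$ be independent copies of $O$. Define $e_{\mathrm{orig}}=\mathbb E\big[(Y^{(a)}-f_0(X^{(a)},\boldsymbol Z^{(a)}))^2\big]$ and $e_{\mathrm{switch}}=\mathbb E\big[(Y^{(a)}-f_0(X^{(b)},\boldsymbol Z^{(a)}))^2\big]$ (all expectations assumed finite), and the Marginal Variable Importance Metric (MVIM)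 $\mathcal{MI}_X=e_{\mathrm{switch}}-e_{\mathrm{orig}}$. For each treatment level $x$, $Y_x$ denotes the potential outcome under $X=x$. *)

(* Defs.v *)
From HB Require Import structures.
From mathcomp Require Import all_boot all_order all_algebra.
From mathcomp Require Import all_classical all_reals all_analysis.
Set Implicit Arguments. Unset Strict Implicit. Unset Printing Implicit Defensive.
Import Order.TTheory GRing.Theory Num.Theory.
Local Open Scope classical_set_scope.
Local Open Scope ring_scope.

Definition cexpZ d dZ (Om : measurableType d) (TZ : measurableType dZ)
    (R : realType) (P : probability Om R) (Z : Om -> TZ)
    (V : Om -> R) (g : TZ -> R) : Prop :=
  [/\ measurable_fun setT g,
      P.-integrable setT (fun w => (g (Z w))%:E) &
      forall B, measurable B ->
        (\int[P]_(w in Z @^-1` B) (V w)%:E =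
         \int[P]_(w in Z @^-1` B) (g (Z w))%:E)%E].

(* [cexpXZ P X Z V f] : (x, z) |-> f x z is a version of the conditional
   expectation E(V | X = x, Z = z), X taking values in 'I_K, i.e.
   f(X, Z) is a version of E(V | sigma(X, Z)).  Since X is discrete, the events
   of sigma(X,Z) are the finite disjoint unions of {X = x} /\ {Z in B}. *)
Definition cexpXZ d dZ (Om : measurableType d) (TZ : measurableType dZ)
    (R : realType) (P : probability Om R) (K : nat) (X : Om -> 'I_K)
    (Z : Om -> TZ) (V : Om -> R) (f : 'I_K -> TZ -> R) : Prop :=
  [/\ forall x, measurable_fun setT (f x),
      P.-integrable setT (fun w => (f (X w) (Z w))%:E) &
      forall x B, measurable B ->
        (\int[P]_(w in X @^-1` [set x] `&` Z @^-1` B) (V w)%:E =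
         \int[P]_(w in X @^-1` [set x] `&` Z @^-1` B) (f (X w) (Z w))%:E)%E].

(* Conditional ignorability (Y_1,...,Y_K) _||_ X | Z : for every event A of
   sigma(Y_1,...,Y_K) and every level x,
   P(A /\ X = x | Z) = P(A | Z) P(X = x | Z)  a.s.,
   i.e. the product of versions of the two factors is a version of the left side. *)
Definition cond_indep_Z d dZ (Om : measurableType d) (TZ : measurableType dZ)
    (R : realType) (P : probability Om R) (K : nat) (Yp : 'I_K -> Om -> R)
    (X : Om -> 'I_K) (Z : Om -> TZ) : Prop :=
  forall A, g_sigma_preimage Yp A -> forall x : 'I_K,
    exists g h : TZ -> R,
      [/\ cexpZ P Z (\1_A) g,
          cexpZ P Z (\1_(X @^-1` [set x])) h &
          cexpZ P Z (\1_(A `&` X @^-1` [set x])) (fun z => g z * h z)].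

Definition pX d (Om : measurableType d) (R : realType) (P : probability Om R)
    (K : nat) (X : Om -> 'I_K) (x : 'I_K) : R :=
  fine (P (X @^-1` [set x])).

Definition EZgivenX d dZ (Om : measurableType d) (TZ : measurableType dZ)
    (R : realType) (P : probability Om R) (K : nat) (X : Om -> 'I_K)
    (Z : Om -> TZ) (x : 'I_K) (h : TZ -> R) : R :=
  Rintegral P (X @^-1` [set x]) (fun w => h (Z w)) / pX P X x.

(* Independent copies O^(a), O^(b) of O are realized as the two coordinates of
   the product probability space (Om * Om, P \x P). *)
Definition e_orig d dZ (Om : measurableType d) (TZ : measurableType dZ)
    (R : realType) (P : probability Om R) (K : nat) (Y : Om -> R)
    (X : Om -> 'I_K) (Z : Om -> TZ) (f0 : 'I_K -> TZ -> R) : R :=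
  Rintegral P setT (fun w => (Y w - f0 (X w) (Z w)) ^+ 2).

Definition e_switch d dZ (Om : measurableType d) (TZ : measurableType dZ)
    (R : realType) (P : probability Om R) (K : nat) (Y : Om -> R)
    (X : Om -> 'I_K) (Z : Om -> TZ) (f0 : 'I_K -> TZ -> R) : R :=
  Rintegral (P \x P)%E setT (fun w => (Y w.1 - f0 (X w.2) (Z w.1)) ^+ 2).

Definition MVIM d dZ (Om : measurableType d) (TZ : measurableType dZ)
    (R : realType) (P : probability Om R) (K : nat) (Y : Om -> R)
    (X : Om -> 'I_K) (Z : Om -> TZ) (f0 : 'I_K -> TZ -> R) : R :=
  e_switch P Y X Z f0 - e_orig P Y X Z f0.

(* Main.v *)
(* Since X^(b) is an independent copy, e_switch is the p_x'-weighted mean over x' of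
   E[(Y - f0(x', Z))^2].  On {X = x}, Y - f0(x, Z) is orthogonal to functions of Z,
   so E[(Y - f0(x', Z))^2 - (Y - f0(x, Z))^2; X = x] =
   E[(f0(x, Z) - f0(x', Z))^2; X = x], and summing with weights p_x' gives the
   formula with f0 in place of mu.  Ignorability extends from events to
   E[Y_x 1_{X = x} | Z] = mu_x(Z) pi_x(Z), hence f0(x, Z) = mu_x(Z) almost surely
   on {X = x}, and on the whole space because pi_x > 0. *)
Require Import Defs.
From HB Require Import structures.
From mathcomp Require Import all_boot all_order all_algebra.
From mathcomp Require Import all_classical all_reals all_analysis.
From mathcomp Require Import measurable_realfun measurable_fun_approximation.
From mathcomp Require Import simple_functions ring lra.
Import Order.TTheory GRing.Theory Num.Theory.
Local Open Scope classical_set_scope.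
Local Open Scope ring_scope.

(** * Orthogonality to functions of a random variable, by the standard machine *)

Section orthogonality.
Import numFieldNormedType.Exports.
Set Implicit Arguments. Unset Strict Implicit.
Context {R : realType} {d} {Om : measurableType d} (P : probability Om R).
Context {dT} {TT : measurableType dT} (D : set Om) (T : Om -> TT).
Hypotheses (mD : measurable D) (mT : measurable_fun setT T).

Lemma le_integrable_EFin (f g : Om -> R) :
  measurable_fun D f -> (forall w, D w -> `|f w| <= `|g w|) ->
  P.-integrable D (EFin \o g) -> P.-integrable D (EFin \o f).
Proof.
by move=> mf fg; apply: le_integrable => //; exact/measurable_EFinP.
Qed.

Lemma Rintegral_sum (I : Type) (s : seq I) (f : I -> Om -> R) :
  (forall i, P.-integrable D (EFin \o f i)) ->
  \int[P]_(w in D) (\sum_(i <- s) f i w) = \sum_(i <- s) \int[P]_(w in D) f i w.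
Proof.
move=> fi; rewrite /Rintegral; under eq_integral do rewrite -sumEFin.
rewrite integral_sum// -sum_fine// => i _.
exact: (integrable_fin_num mD (fi i)).
Qed.

(** [W] models a residual such as [V - E(V | T)] on [D]: its integral vanishes over every event of
    [D] cut out by [T]. *)
Variable W : Om -> R.
Hypotheses (iW : P.-integrable D (EFin \o W))
  (W0 : forall B, measurable B -> \int[P]_(w in D `&` T @^-1` B) W w = 0).

Let mW : measurable_fun D W.
Proof. exact/measurable_EFinP/measurable_int/iW. Qed.

Let mcomp (phi : TT -> R) : measurable_fun setT phi ->
  measurable_fun D (fun w => phi (T w)).
Proof. by move=> mphi; apply: measurable_funTS; exact: measurableT_comp. Qed.

Lemma orth_indic B : measurable B ->
  P.-integrable D (EFin \o (fun w => \1_B (T w) * W w)) /\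
  \int[P]_(w in D) (\1_B (T w) * W w) = 0.
Proof.
move=> mB; split.
  apply: le_integrable_EFin iW.
    by apply: measurable_funM => //; exact: (mcomp (measurable_indic mB)).
  move=> w _; rewrite normrM indicE.
  by case: (_ \in _); rewrite ?normr1 ?normr0 ?mul1r ?mul0r.
rewrite -[RHS](W0 mB) Rintegral_mkcondr; apply: eq_Rintegral => w _.
rewrite patchE indicE (_ : (T w \in B) = (w \in T @^-1` B)).
  by case: ifPn; rewrite ?mul1r ?mul0r.
by apply/idP/idP; rewrite !inE.
Qed.

Import HBNNSimple.

(** By linearity from indicators, since [g] is a finite combination of the indicators of its
    fibres. *)
Lemma orth_nnsfun (g : {nnsfun TT >-> R}) :
  \int[P]_(w in D) (g (T w) * W w) = 0.
Proof.
have mg y : measurable (g @^-1` [set y]) by [].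
have fi (y : R) : P.-integrable D
    (EFin \o (fun w => y * \1_(g @^-1` [set y]) (T w) * W w)).
  have [iy _] := orth_indic (mg y).
  have := integrableZl mD y iy; apply: eq_integrable => // w _.
  by rewrite /= -EFinM mulrA.
under eq_Rintegral do rewrite fimfunE fsbig_finite// mulr_suml.
rewrite (Rintegral_sum _ fi); apply: big1 => y _.
under eq_Rintegral do rewrite -mulrA.
have [iy y0] := orth_indic (mg y).
by rewrite RintegralZl// y0 mulr0.
Qed.

(** Simple functions increase to [phi], and [|phi(T) W|] dominates every approximating product;
    boundedness of [phi] is thus replaced by integrability of the product. *)
Lemma orth_ge0 (phi : TT -> R) : measurable_fun setT phi ->
  (forall t, 0 <= phi t) ->
  P.-integrable D (EFin \o (fun w => phi (T w) * W w)) ->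
  \int[P]_(w in D) (phi (T w) * W w) = 0.
Proof.
move=> mphi phi0 iphi.
have mphi' : measurable_fun setT (EFin \o phi) by exact/measurable_EFinP.
pose g := nnsfun_approx measurableT mphi'.
have gphi t : g ^~ t @ \oo --> phi t.
  have /fine_cvgP[_] : EFin \o g ^~ t @ \oo --> (phi t)%:E.
    by apply: cvg_nnsfun_approx => // x _; rewrite lee_fin.
  exact.
have le_g n t : g n t <= phi t.
  rewrite -(cvg_lim _ (gphi t))//.
  apply: (@nondecreasing_cvgn_le _ (g ^~ t)).
    by move=> m k mk; exact/lefP/nd_nnsfun_approx.
  by apply/cvg_ex; exists (phi t).
have ig n : P.-integrable D (EFin \o (fun w => g n (T w) * W w)).
  apply: le_integrable_EFin iphi.
    by apply: measurable_funM => //; exact: mcomp.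
  by move=> w _; rewrite !normrM ler_wpM2r// !ger0_norm ?le_g// ?fun_ge0.
have ig0 n : (\int[P]_(w in D) (g n (T w) * W w)%:E = 0)%E.
  rewrite -[LHS]fineK; last exact: (integrable_fin_num mD (ig n)).
  by have := orth_nnsfun (g n); rewrite /Rintegral => ->.
have [|||||_ _] := @dominated_convergence _ _ _ P D mD
   (fun n w => (g n (T w) * W w)%:E) (fun w => (phi (T w) * W w)%:E)
   (fun w => `|phi (T w) * W w|%:E).
- by move=> n; exact: measurable_int (ig n).
- exact: measurable_int iphi.
- apply: aeW => w _; apply/fine_cvgP; split; first exact: nearW.
  by apply: cvgMl => //; exact: gphi.
- exact: integrable_norm.
- apply: aeW => w n _; rewrite lee_fin !normrM ler_wpM2r//.
  by rewrite !ger0_norm ?le_g// ?fun_ge0.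
under eq_fun do rewrite ig0.
by move=> /cvg_lim phiE; rewrite /Rintegral -phiE// lim_cst.
Qed.

(** Split [phi] into positive and negative parts; each is at most [|phi|], so both products with [W]
    stay integrable. *)
Lemma orthE (phi : TT -> R) : measurable_fun setT phi ->
  P.-integrable D (EFin \o (fun w => phi (T w) * W w)) ->
  \int[P]_(w in D) (phi (T w) * W w) = 0.
Proof.
move=> mphi iphi.
pose phip t := Num.max (phi t) 0; pose phin t := Num.max (- phi t) 0.
have mp : measurable_fun setT phip by exact: measurable_maxr.
have mn : measurable_fun setT phin.
  by apply: measurable_maxr => //; exact: measurableT_comp.
have phiE t : phi t = phip t - phin t.
  by rewrite /phip /phin; case: (lerP (phi t) 0); case: (lerP (- phi t) 0); lra.
have ip : P.-integrable D (EFin \o (fun w => phip (T w) * W w)).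
  apply: le_integrable_EFin iphi; first by apply: measurable_funM => //; exact: mcomp.
  move=> w _; rewrite !normrM ler_wpM2r// /phip.
  by case: (lerP (phi (T w)) 0) => _; rewrite ?normr0.
have im : P.-integrable D (EFin \o (fun w => phin (T w) * W w)).
  apply: le_integrable_EFin iphi; first by apply: measurable_funM => //; exact: mcomp.
  move=> w _; rewrite !normrM ler_wpM2r// /phin.
  by case: (lerP (- phi (T w)) 0) => _; rewrite ?normr0 ?normrN.
under eq_Rintegral do rewrite phiE mulrBl.
rewrite RintegralB// !orth_ge0 ?subrr// => t; rewrite /phip /phin.
  by rewrite le_max lexx orbT.
by rewrite le_max lexx orbT.
Qed.

End orthogonality.

(** * Comparing integrands through their integrals over the events of sigma(T) *)

Section sigma_T_equality.
Set Implicit Arguments. Unset Strict Implicit.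
Context {R : realType} {d} {Om : measurableType d} (P : probability Om R).
Context {dT} {TT : measurableType dT} (D : set Om) (T : Om -> TT).
Hypotheses (mD : measurable D) (mT : measurable_fun setT T).

Lemma orth_sub (U V : Om -> R) :
  P.-integrable D (EFin \o U) -> P.-integrable D (EFin \o V) ->
  (forall B, measurable B -> \int[P]_(w in D `&` T @^-1` B) U w =
                             \int[P]_(w in D `&` T @^-1` B) V w) ->
  forall B, measurable B -> \int[P]_(w in D `&` T @^-1` B) (U w - V w) = 0.
Proof.
move=> iU iV UV B mB.
have mDB : measurable (D `&` T @^-1` B).
  by apply: measurableI => //; rewrite -[X in measurable X]setTI; exact: mT.
rewrite RintegralB//; first by rewrite UV// subrr.
- by apply: integrableS iU.
- by apply: integrableS iV.
Qed.

(** The difference [U - V] is a residual in the sense of [orthE]. This lets one integrand replace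
    another against any test function of [T]. *)
Lemma Rintegral_test (U V : Om -> R) (phi : TT -> R) :
  P.-integrable D (EFin \o U) -> P.-integrable D (EFin \o V) ->
  (forall B, measurable B -> \int[P]_(w in D `&` T @^-1` B) U w =
                             \int[P]_(w in D `&` T @^-1` B) V w) ->
  measurable_fun setT phi ->
  P.-integrable D (EFin \o (fun w => phi (T w) * U w)) ->
  P.-integrable D (EFin \o (fun w => phi (T w) * V w)) ->
  \int[P]_(w in D) (phi (T w) * U w) = \int[P]_(w in D) (phi (T w) * V w).
Proof.
move=> iU iV UV mphi ipU ipV; apply/eqP; rewrite -subr_eq0 -RintegralB//.
under eq_Rintegral do rewrite -mulrBr.
rewrite (orthE mD mT (integrableB mD iU iV) (orth_sub iU iV UV) mphi)//.
have := integrableB mD ipU ipV; apply: eq_integrable => // w _.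
by rewrite /= -EFinB mulrBr.
Qed.

Lemma ae_unique (a b : TT -> R) :
  measurable_fun setT a -> measurable_fun setT b ->
  P.-integrable D (EFin \o (a \o T)) -> P.-integrable D (EFin \o (b \o T)) ->
  (forall B, measurable B -> \int[P]_(w in D `&` T @^-1` B) a (T w) =
                             \int[P]_(w in D `&` T @^-1` B) b (T w)) ->
  {ae P, forall w, D w -> a (T w) = b (T w)}.
Proof.
move=> ma mb ia ib ab.
have iab := integrableB mD ia ib.
(* [phi] is the sign of [a - b]; tested against it, the residual [a(T) - b(T)] turns into its
   absolute value, whose integral must then be zero. *)
pose phi t : R := \1_[set t | b t < a t] t - \1_[set t | a t < b t] t.
have mphi : measurable_fun setT phi.
  apply: measurable_funB; apply: measurable_indic; rewrite -[X in measurable X]setTI.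
    exact: (measurable_fun_ltr mb ma measurableT (I : measurable [set true])).
  exact: (measurable_fun_ltr ma mb measurableT (I : measurable [set true])).
have phiE t : phi t * (a t - b t) = `|a t - b t|.
  rewrite /phi !indicE.
  have [h|h|h] := ltgtP (a t) (b t).
  - rewrite memNset ?mem_set//=; last by rewrite lt_gtF.
    by rewrite ltr0_norm ?subr_lt0// sub0r mulN1r.
  - rewrite mem_set ?memNset//=; last by rewrite lt_gtF.
    by rewrite gtr0_norm ?subr_gt0// subr0 mul1r.
  - by rewrite h subrr mulr0 normr0.
have iabs : P.-integrable D (EFin \o (fun w => phi (T w) * (a (T w) - b (T w)))).
  have := integrable_abse iab; apply: eq_integrable => // w _.
  by rewrite /= phiE.
have /eqP := orthE mD mT iab (orth_sub ia ib ab) mphi iabs.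
rewrite -eqe fineK; last exact: (integrable_fin_num mD iabs).
under eq_integral do rewrite phiE.
move=> /eqP abs0.
have mab := measurable_int _ iab.
have /(ae_eq_integral_abs P mD mab) :
  (\int[P]_(w in D) `|((a \o T) w)%:E - ((b \o T) w)%:E| = 0)%E by exact: abs0.
apply: filterS => w /= + Dw => /(_ Dw) /eqP.
by rewrite -EFinB eqe subr_eq0 => /eqP.
Qed.
End sigma_T_equality.

(** * From conditional independence of events to identification of the regression *)

Section ignorability.
Set Implicit Arguments. Unset Strict Implicit.
Context {R : realType} {d} {Om : measurableType d} (P : probability Om R).
Context {dZ} {TZ : measurableType dZ} (Z : Om -> TZ).
Hypothesis mZ : measurable_fun setT Z.

Lemma integrable_contract (b f : Om -> R) :
  measurable_fun setT b -> (forall w, `|b w| <= 1) ->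
  P.-integrable setT (EFin \o f) ->
  P.-integrable setT (EFin \o (fun w => b w * f w)).
Proof.
move=> mb b1 intf; apply: le_integrable_EFin (intf) => //.
  apply: measurable_funM => //; exact/measurable_EFinP/measurable_int/intf.
by move=> w _; rewrite normrM ler_piMl.
Qed.

Lemma RintegralE_indic (D : set Om) (f : Om -> R) :
  \int[P]_(w in D) f w = \int[P]_w (\1_D w * f w).
Proof.
rewrite Rintegral_mkcond; apply: eq_Rintegral => w _.
by rewrite patchE indicE; case: ifPn; rewrite ?mul1r ?mul0r.
Qed.

Lemma normr_indic_le1 {T} (A : set T) t : `|\1_A t : R| <= 1.
Proof. by rewrite indicE; case: (_ \in _); rewrite ?normr1 ?normr0. Qed.

Let mcompZ (phi : TZ -> R) : measurable_fun setT phi ->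
  measurable_fun setT (fun w => phi (Z w)).
Proof. by move=> mphi; exact: measurableT_comp. Qed.

Lemma cexpZ_test (V : Om -> R) (g phi : TZ -> R) : cexpZ P Z V g ->
  P.-integrable setT (EFin \o V) -> measurable_fun setT phi ->
  P.-integrable setT (EFin \o (fun w => phi (Z w) * V w)) ->
  P.-integrable setT (EFin \o (fun w => phi (Z w) * g (Z w))) ->
  \int[P]_w (phi (Z w) * V w) = \int[P]_w (phi (Z w) * g (Z w)).
Proof.
move=> [mg ig Vg] iV mphi ipV ipg; apply: (@Rintegral_test _ _ _ _ _ _ setT Z) => //.
by move=> B mB; rewrite setTI /Rintegral Vg.
Qed.

Lemma ae_cexpZ (V : Om -> R) (g h : TZ -> R) : cexpZ P Z V g -> cexpZ P Z V h ->
  {ae P, forall w, g (Z w) = h (Z w)}.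
Proof.
move=> [mg ig Vg] [mh ih Vh].
have : {ae P, forall w, setT w -> g (Z w) = h (Z w)}.
  apply: (@ae_unique _ _ _ P _ _ setT Z) => // B mB.
  by rewrite setTI /Rintegral -Vg// Vh.
by apply: filterS => w; apply.
Qed.

Lemma eq_ae_Rintegral (D : set Om) (f g : Om -> R) : measurable D ->
  measurable_fun D f -> measurable_fun D g ->
  {ae P, forall w, D w -> f w = g w} ->
  \int[P]_(w in D) f w = \int[P]_(w in D) g w.
Proof.
move=> mD mf mg fg; congr fine; apply: ae_eq_integral => //.
- exact/measurable_EFinP.
- exact/measurable_EFinP.
by apply: filterS fg => w /= + Dw => ->.
Qed.

(** The chain is [1_A 1_D -> g h -> 1_A h -> 1_A p] under the factor [1_B(Z)]. It trades the
    versions [g], [h], which depend on [A], for one fixed version [p] of [P(D | Z)]. *)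
Lemma cond_indep_event (A D : set Om) (p g h : TZ -> R) (B : set TZ) :
  measurable A -> measurable D -> measurable B ->
  cexpZ P Z (\1_A) g -> cexpZ P Z (\1_D) h ->
  cexpZ P Z (\1_(A `&` D)) (fun z => g z * h z) ->
  cexpZ P Z (\1_D) p ->
  \int[P]_w (\1_A w * (\1_D w * \1_B (Z w))) =
  \int[P]_w (\1_A w * (p (Z w) * \1_B (Z w))).
Proof.
move=> mA mD mB cA cD cAD cp.
have [mg ig _] := cA; have [mh ih _] := cD; have [_ igh _] := cAD.
have [mp ip _] := cp.
have i1 (C : set Om) : measurable C -> P.-integrable setT (EFin \o (\1_C : Om -> R)).
  by move=> mC; exact: integrable_indic.
have mAB : measurable (A `&` D) by exact: measurableI.
have mB1 : measurable_fun setT (fun w => \1_B (Z w) : R).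
  by apply: mcompZ; exact: measurable_indic.
have mA1 : measurable_fun setT (\1_A : Om -> R) by exact: measurable_indic.
transitivity (\int[P]_w (\1_B (Z w) * (g (Z w) * h (Z w)))).
  rewrite -(cexpZ_test cAD); last 4 first.
  - exact: i1.
  - exact: measurable_indic.
  - by apply: integrable_contract => // [w|]; [exact: normr_indic_le1|exact: i1].
  - by apply: integrable_contract => // w; exact: normr_indic_le1.
  apply: eq_Rintegral => w _; rewrite indicI /=; ring.
have ihB : P.-integrable setT (EFin \o (fun w => \1_B (Z w) * h (Z w))).
  by apply: integrable_contract => // w; exact: normr_indic_le1.
(* Since [1_B h] is a function of [Z], it can serve as test function to read [g] back as [1_A]. *)
transitivity (\int[P]_w (\1_B (Z w) * h (Z w) * \1_A w)).
  have -> : \int[P]_w (\1_B (Z w) * (g (Z w) * h (Z w))) =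
      \int[P]_w (\1_B (Z w) * h (Z w) * g (Z w)).
    by apply: eq_Rintegral => w _; ring.
  apply/esym/(cexpZ_test (phi := fun z => \1_B z * h z) cA).
  - exact: i1.
  - by apply: measurable_funM => //; exact: measurable_indic.
  - have := integrable_contract mA1 (normr_indic_le1 A) ihB.
    by apply: eq_integrable => // w _ /=; rewrite mulrC.
  - have : P.-integrable setT (EFin \o (fun w => \1_B (Z w) * (g (Z w) * h (Z w)))).
      by apply: integrable_contract => // w; exact: normr_indic_le1.
    by apply: eq_integrable => // w _ /=; rewrite mulrA mulrAC.
(* [h] and [p] are two versions of the same conditional probability, so they agree almost surely
   along [Z]. *)
apply: eq_ae_Rintegral => //.
- apply: measurable_funM => //; apply: measurable_funM => //; exact: mcompZ.
- apply: measurable_funM => //; apply: measurable_funM => //; exact: mcompZ.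
apply: filterS (ae_cexpZ cD cp) => w -> _; ring.
Qed.

(** Under the factor [1_B(Z)] the chain is [V 1_D -> V p -> m p -> m 1_D]: first independence, then
    the definition of [m], then that of [p]. *)
Lemma cond_indep_mean (D : set Om) (V : Om -> R) (p m : TZ -> R) (B : set TZ) :
  measurable D -> measurable B -> measurable_fun setT V ->
  P.-integrable setT (EFin \o V) ->
  (forall S, measurable S -> exists g h : TZ -> R,
    [/\ cexpZ P Z (\1_(V @^-1` S)) g, cexpZ P Z (\1_D) h &
        cexpZ P Z (\1_(V @^-1` S `&` D)) (fun z => g z * h z)]) ->
  cexpZ P Z (\1_D) p -> (forall z, 0 < p z < 1) -> cexpZ P Z V m ->
  \int[P]_w (V w * (\1_D w * \1_B (Z w))) =
  \int[P]_w (m (Z w) * (\1_D w * \1_B (Z w))).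
Proof.
move=> mD mB mV iV VD cD p01 cV.
have [mp ip _] := cD; have [mm im _] := cV.
have p1 z : `|p z| <= 1.
  by have /andP[p0 p1] := p01 z; rewrite ger0_norm ltW.
have mDB : measurable_fun setT (fun w => \1_D w * \1_B (Z w) : R).
  apply: measurable_funM; first exact: measurable_indic.
  by apply: mcompZ; exact: measurable_indic.
have mpB : measurable_fun setT (fun z => p z * \1_B z : R).
  by apply: measurable_funM => //; exact: measurable_indic.
have DB1 w : `|\1_D w * \1_B (Z w) : R| <= 1.
  by rewrite normrM mulr_ile1 ?normr_indic_le1.
have pB1 z : `|p z * \1_B z : R| <= 1.
  by rewrite normrM mulr_ile1 ?normr_indic_le1.
have mulC (f g : Om -> R) : P.-integrable setT (EFin \o (fun w => f w * g w)) ->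
    P.-integrable setT (EFin \o (fun w => g w * f w)).
  by apply: eq_integrable => // w _ /=; rewrite mulrC.
have i1 : P.-integrable setT (EFin \o (cst 1 : Om -> R)).
  exact: finite_measure_integrable_cst.
have mulr1f (f : Om -> R) : P.-integrable setT (EFin \o (fun w => f w * cst 1 w)) ->
    P.-integrable setT (EFin \o f).
  by apply: eq_integrable => // w _ /=; rewrite mulr1.
have iDB := integrable_contract mDB DB1.
have ipB := integrable_contract (mcompZ mpB) (fun w => pB1 (Z w)).
transitivity (\int[P]_w (V w * (p (Z w) * \1_B (Z w)))).
  (* Here sigma(V) takes the place of sigma(Z): [1_D 1_B(Z)] and [p(Z) 1_B(Z)] have equal integrals
     over each event [V^{-1}(S)], and the test function is the identity applied to [V]. This passes
     from events to means in one step. *)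
  apply: (@Rintegral_test _ _ _ P _ _ setT V measurableT mV
    (fun w => \1_D w * \1_B (Z w)) (fun w => p (Z w) * \1_B (Z w)) id) => //.
  - exact/mulr1f/iDB.
  - exact/mulr1f/ipB.
  - move=> S mS; rewrite setTI.
    have mVS : measurable (V @^-1` S) by rewrite -[X in measurable X]setTI; exact: mV.
    have [g [h [cg ch cgh]]] := VD S mS.
    have := cond_indep_event mVS mD mB cg ch cgh cD.
    by rewrite !(RintegralE_indic (V @^-1` S)).
  - exact/mulC/iDB.
  - exact/mulC/ipB.
transitivity (\int[P]_w (p (Z w) * \1_B (Z w) * m (Z w))).
  under eq_Rintegral do rewrite mulrC.
  apply: (cexpZ_test (phi := fun z => p z * \1_B z) cV) => //.
  - exact: ipB.
  - exact: ipB.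
transitivity (\int[P]_w (m (Z w) * \1_B (Z w) * p (Z w))).
  by apply: eq_Rintegral => w _; ring.
rewrite -(cexpZ_test (phi := fun z => m z * \1_B z) cD).
- by apply: eq_Rintegral => w _; ring.
- exact: integrable_indic.
- by apply: measurable_funM => //; exact: measurable_indic.
- have := iDB _ im; apply: eq_integrable => // w _ /=; congr EFin; ring.
- have := ipB _ im; apply: eq_integrable => // w _ /=; congr EFin; ring.
Qed.

(* Positivity propagates the identity of the two regressions from {X = x} to
   the whole space. *)
Lemma regression_identification (D : set Om) (V : Om -> R) (p m f : TZ -> R) :
  measurable D -> measurable_fun setT V -> P.-integrable setT (EFin \o V) ->
  (forall S, measurable S -> exists g h : TZ -> R,
    [/\ cexpZ P Z (\1_(V @^-1` S)) g, cexpZ P Z (\1_D) h &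
        cexpZ P Z (\1_(V @^-1` S `&` D)) (fun z => g z * h z)]) ->
  cexpZ P Z (\1_D) p -> (forall z, 0 < p z < 1) -> cexpZ P Z V m ->
  measurable_fun setT f -> P.-integrable D (EFin \o (f \o Z)) ->
  (forall B, measurable B -> \int[P]_(w in D `&` Z @^-1` B) V w =
                             \int[P]_(w in D `&` Z @^-1` B) f (Z w)) ->
  {ae P, forall w, f (Z w) = m (Z w)}.
Proof.
move=> mD mV iV VD cD p01 cV mf intf Vf.
have [mp ip pD] := cD; have [mm im _] := cV.
(* [V], [f(Z)] and [m(Z)] have the same integrals over each [D] intersected with [{Z in B}], so
   uniqueness applies within [D]. *)
have fmD : {ae P, forall w, D w -> f (Z w) = m (Z w)}.
  apply: ae_unique => // [|B mB]; first exact: integrableS im.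
  rewrite -Vf//; have := cond_indep_mean mD mB mV iV VD cD p01 cV.
  rewrite !(RintegralE_indic (D `&` Z @^-1` B)).
  have indicM (g : Om -> R) : \int[P]_w (\1_(D `&` Z @^-1` B) w * g w) =
      \int[P]_w (g w * (\1_D w * \1_B (Z w))).
    by apply: eq_Rintegral => w _; rewrite indicI mulrC.
  by rewrite !indicM.
(* The event [D] and [{Z in N}] is null by [fmD]. Its probability is also the integral of [p(Z)]
   over [{Z in N}]; as [p > 0], the event [{Z in N}] is null. *)
pose N := [set z | f z != m z].
have mN : measurable N.
  rewrite -[X in measurable X]setTI.
  have := measurable_fun_eqr mf mm measurableT (I : measurable [set false]).
  by congr (measurable (_ `&` _)); apply/seteqP; split => z /=;
    rewrite /N /=; [move=> ->|move/negbTE].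
have mZN : measurable (Z @^-1` N) by rewrite -[X in measurable X]setTI; exact: mZ.
have DN0 : (\int[P]_(w in Z @^-1` N) (\1_D w)%:E = 0)%E.
  rewrite integral_indic//.
  have [M [mM M0 fM]] := fmD.
  apply: (subset_measure0 _ _ _ M0) => //; first exact: measurableI.
  move=> w /= [Dw /eqP Nw]; apply: fM => /= fmw; exact/Nw/fmw.
have ipN : P.-integrable (Z @^-1` N) (fun w => (p (Z w))%:E).
  exact: integrableS ip.
have /(ae_eq_integral_abs P mZN (measurable_int _ ipN)) :
  (\int[P]_(w in Z @^-1` N) `|(p (Z w))%:E| = 0)%E.
  rewrite -DN0 pD//; apply: eq_integral => w _ /=.
  by rewrite ger0_norm//; have /andP[/ltW] := p01 (Z w).
apply: filterS => w /= p0; apply: contrapT => /eqP fm.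
have [] := p0 fm => /eqP; have /andP[/gt_eqF] := p01 (Z w).
by move=> ->.
Qed.
End ignorability.

(** * Square integrability and the excess risk of a wrong regression function *)

Section excess_risk.
Set Implicit Arguments. Unset Strict Implicit.
Context {R : realType} {d} {Om : measurableType d} (P : probability Om R).

Lemma ler_normM_sqr (u v : R) : `|u * v| <= u ^+ 2 + v ^+ 2.
Proof.
have uv := sqr_ge0 (u + v); have vu := sqr_ge0 (u - v).
by rewrite ler_norml; apply/andP; split; nra.
Qed.

(** Uses [|Y| <= 1 + Y^2] and the finiteness of [P]. *)
Lemma integrable_sqr (D : set Om) (Y : Om -> R) : measurable D ->
  measurable_fun D Y -> P.-integrable D (EFin \o (fun w => Y w ^+ 2)) ->
  P.-integrable D (EFin \o Y).
Proof.
move=> mD mY iY2.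
have i1 : P.-integrable D (EFin \o (cst 1 : Om -> R)).
  exact: finite_measure_integrable_cst.
apply: (@le_integrable_EFin _ _ _ _ _ mD _ (fun w => 1 + Y w ^+ 2)) => //.
  move=> w _; rewrite [leRHS]ger0_norm; last by rewrite addr_ge0// sqr_ge0.
  by rewrite ler_norml; apply/andP; split; nra.
exact: (integrableD mD i1 iY2).
Qed.

(* The cross term (Y - a)(a - b) integrates to zero, a - b being a function of Z. *)
Lemma excess_risk {dZ} {TZ : measurableType dZ} (Z : Om -> TZ)
    (D : set Om) (Y : Om -> R) (a b : TZ -> R) :
  measurable D -> measurable_fun setT Z -> measurable_fun setT a ->
  measurable_fun setT b -> P.-integrable D (EFin \o Y) ->
  P.-integrable D (EFin \o (a \o Z)) ->
  (forall B, measurable B -> \int[P]_(w in D `&` Z @^-1` B) Y w =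
                             \int[P]_(w in D `&` Z @^-1` B) a (Z w)) ->
  P.-integrable D (EFin \o (fun w => (Y w - a (Z w)) ^+ 2)) ->
  P.-integrable D (EFin \o (fun w => (Y w - b (Z w)) ^+ 2)) ->
  \int[P]_(w in D) (Y w - b (Z w)) ^+ 2 - \int[P]_(w in D) (Y w - a (Z w)) ^+ 2 =
  \int[P]_(w in D) (a (Z w) - b (Z w)) ^+ 2.
Proof.
move=> mD mZ ma mb iY iaZ Ya ia ib.
have mYD : measurable_fun D Y by exact/measurable_EFinP/measurable_int/iY.
have maZ : measurable_fun D (a \o Z).
  by apply: measurable_funTS; exact: measurableT_comp.
have mbZ : measurable_fun D (b \o Z).
  by apply: measurable_funTS; exact: measurableT_comp.
have iab := integrableD mD ia ib.
(* Dominated through [(a - b)^2 <= 2 (Y - a)^2 + 2 (Y - b)^2]. *)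
have isq : P.-integrable D (EFin \o (fun w => (a (Z w) - b (Z w)) ^+ 2)).
  apply: le_integrable_EFin (integrableD mD iab iab) => //.
    by apply: measurable_funX; exact: measurable_funB.
  move=> w _ /=; rewrite !ger0_norm ?addr_ge0 ?sqr_ge0//.
  have := sqr_ge0 (Y w - a (Z w) + (Y w - b (Z w))); nra.
have icross : P.-integrable D
    (EFin \o (fun w => (a (Z w) - b (Z w)) * (Y w - a (Z w)))).
  apply: le_integrable_EFin (integrableD mD isq ia) => //.
    by apply: measurable_funM; exact: measurable_funB.
  move=> w _ /=; rewrite [leRHS]ger0_norm ?addr_ge0 ?sqr_ge0//.
  exact: ler_normM_sqr.
have cross0 := orthE mD mZ (integrableB mD iY iaZ) (orth_sub mD mZ iY iaZ Ya)
  (measurable_funB ma mb) icross.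
rewrite -RintegralB//.
(* Expand [Y - b = (Y - a) + (a - b)]; the squares of [Y - a] cancel. *)
transitivity (\int[P]_(w in D) ((a (Z w) - b (Z w)) ^+ 2 +
   2 * ((a (Z w) - b (Z w)) * (Y w - a (Z w))))).
  by apply: eq_Rintegral => w _; ring.
rewrite RintegralD//; last exact: (integrableZl mD 2 icross).
by rewrite RintegralZl// cross0 mulr0 addr0.
Qed.

(** * Decomposition over treatment levels and the switched risk *)

Variables (K : nat) (X : Om -> 'I_K).
Hypothesis mX : forall x, measurable (X @^-1` [set x]).

(** Exactly one indicator is nonzero at [w]. Since the identity is pointwise, [c] may itself vary
    with [w]. *)
Let sum_level (c : 'I_K -> R) w : c (X w) = \sum_x c x * \1_(X @^-1` [set x]) w.
Proof.
rewrite (bigD1 (X w))//= indicE mem_set// mulr1 big1 ?addr0// => x xX.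
by rewrite indicE memNset ?mulr0//= => /esym/eqP; rewrite (negbTE xX).
Qed.

Lemma measurable_fun_level (g : 'I_K -> Om -> R) :
  (forall x, measurable_fun setT (g x)) ->
  measurable_fun setT (fun w => g (X w) w).
Proof.
move=> mg; under eq_fun do rewrite (sum_level (g^~ _)).
by apply: measurable_sum => x; apply: measurable_funM.
Qed.

Lemma Rintegral_level (f : Om -> R) : P.-integrable setT (EFin \o f) ->
  \int[P]_w f w = \sum_x \int[P]_(w in X @^-1` [set x]) f w.
Proof.
move=> intf; have fE w := sum_level (fun=> f w) w.
have ifx x : P.-integrable setT (EFin \o (fun w => f w * \1_(X @^-1` [set x]) w)).
  have : P.-integrable setT (EFin \o (fun w => \1_(X @^-1` [set x]) w * f w)).
    by apply: integrable_contract => // w; exact: normr_indic_le1.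
  by apply: eq_integrable => // w _ /=; rewrite mulrC.
under eq_Rintegral do rewrite fE.
rewrite (Rintegral_sum measurableT _ ifx); apply: eq_bigr => x _.
rewrite (RintegralE_indic _ (X @^-1` _)).
by apply: eq_Rintegral => w _; rewrite mulrC.
Qed.

(** Kept in the extended reals because it evaluates the inner integral after Tonelli's theorem. *)
Lemma integral_level (c : 'I_K -> R) :
  (\int[P]_w (c (X w))%:E = (\sum_x c x * pX P X x)%:E)%E.
Proof.
have i1 x : P.-integrable setT (EFin \o (fun w => c x * \1_(X @^-1` [set x]) w)).
  exact: integrableZl (integrable_indic _ _).
under eq_integral do rewrite (sum_level c) -sumEFin.
rewrite integral_sum// -sumEFin; apply: eq_bigr => x _.
under eq_integral do rewrite EFinM.
rewrite integralZl//; last exact: integrable_indic.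
by rewrite integral_indic// setIT EFinM /pX fineK// fin_num_measure.
Qed.

Lemma sum_pX : \sum_x pX P X x = 1.
Proof.
have := integral_level (fun=> 1).
rewrite integral_cst// mul1e => /(eq_trans (esym (@probability_setT _ _ _ P))) [->].
by apply: eq_bigr => x _; rewrite mul1r.
Qed.

(* By Tonelli the p_x-weighted mean of the q x is integrable; since p_x > 0, it
   dominates each q x up to a constant. *)
Lemma integrable_switch (q : 'I_K -> Om -> R) :
  (forall x, measurable_fun setT (q x)) -> (forall x w, 0 <= q x w) ->
  (forall x, 0 < pX P X x) ->
  (P \x P)%E.-integrable setT (fun w => (q (X w.2) w.1)%:E) ->
  forall x, P.-integrable setT (EFin \o q x).
Proof.
move=> mq q0 pX0 iq x.
pose Q w := \sum_y q y w * pX P X y.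
have mQ : measurable_fun setT Q.
  by apply: measurable_sum => y; apply: measurable_funM.
have Qge0 w : 0 <= Q w by apply: sumr_ge0 => y _; rewrite mulr_ge0// ltW.
have iQ : P.-integrable setT (EFin \o Q).
  apply/integrableP; split; first exact/measurable_EFinP.
  have /integrableP[mqX qXoo] := iq.
  apply: le_lt_trans qXoo; rewrite le_eqVlt; apply/orP; left; apply/eqP.
  rewrite fubini_tonelli1//; last exact: measurableT_comp.
  apply: eq_integral => w _; rewrite /fubini_F/=.
  under eq_integral do rewrite /= ger0_norm//.
  by rewrite (integral_level (q^~ w)) ger0_norm.
have := integrableZl measurableT (pX P X x)^-1 iQ; apply: le_integrable => //.
  exact/measurable_EFinP.
move=> w _; rewrite /= lee_fin [leLHS]ger0_norm// ger0_norm; last first.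
  by rewrite mulr_ge0// invr_ge0 ltW.
rewrite mulrC ler_pdivlMr// /Q (bigD1 x)//= lerDl.
by apply: sumr_ge0 => y _; rewrite mulr_ge0// ltW.
Qed.

Lemma Rintegral_switch (q : 'I_K -> Om -> R) :
  (forall x w, 0 <= q x w) ->
  (forall x, P.-integrable setT (EFin \o q x)) ->
  (P \x P)%E.-integrable setT (fun w => (q (X w.2) w.1)%:E) ->
  Rintegral (P \x P)%E setT (fun w => q (X w.2) w.1) =
  \sum_x pX P X x * \int[P]_w q x w.
Proof.
move=> q0 intq iq.
have /integrableP[mqX _] := iq.
transitivity (\int[P]_w (\sum_x pX P X x * q x w)).
  (* The second coordinate, which enters only through its treatment, is integrated first and leaves
     a mean weighted by the [p_x]. *)
  congr fine; rewrite fubini_tonelli1//; last by move=> w; rewrite lee_fin.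
  apply: eq_integral => w _; rewrite /fubini_F/= (integral_level (q^~ w)).
  by under eq_bigr do rewrite mulrC.
have ipq x : P.-integrable setT (EFin \o (fun w => pX P X x * q x w)).
  exact: integrableZl (intq x).
rewrite (Rintegral_sum measurableT _ ipq); apply: eq_bigr => x _.
by rewrite RintegralZl.
Qed.
End excess_risk.

(** * Assembling the formula for the importance metric *)

(** Such a preimage is one of the generators. Joint ignorability can thus be applied to a single
    potential outcome. *)
Lemma g_sigma_preimage_coord {d} {rT : measurableType d} {aT : Type} (n : nat)
    (f : 'I_n -> aT -> rT) (i : 'I_n) (S : set rT) :
  measurable S -> g_sigma_preimage f (f i @^-1` S).
Proof.
move=> mS; apply: sub_sigma_algebra; rewrite (bigD1 i)//=; left.
by exists S => //; rewrite setTI.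
Qed.

Theorem theorem1 (R : realType) (d : measure_display) (Om : measurableType d)
  (P : probability Om R) (dZ : measure_display) (TZ : measurableType dZ)
  (K : nat) (X : Om -> 'I_K) (Z : Om -> TZ) (Y : Om -> R)
  (Yp : 'I_K -> Om -> R) (f0 : 'I_K -> TZ -> R) (mu : 'I_K -> TZ -> R)
  (pi : 'I_K -> TZ -> R) :
  (* random variables *)
  (forall x, measurable (X @^-1` [set x])) ->
  measurable_fun setT Z ->
  (forall x, measurable_fun setT (Yp x)) ->
  (forall x, P.-integrable setT (fun w => (Yp x w)%:E)) ->
  P.-integrable setT (fun w => (Y w ^+ 2)%:E) ->
  (* p_x > 0 *)
  (forall x, 0 < pX P X x) ->
  (* consistency *)
  (forall w, Y w = Yp (X w) w) ->
  (* conditional ignorability *)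
  cond_indep_Z P Yp X Z ->
  (* positivity *)
  (forall x, cexpZ P Z (\1_(X @^-1` [set x])) (pi x)) ->
  (forall x z, 0 < pi x z < 1) ->
  (* f0 = E(Y | X, Z), mu x = E(Y_x | Z) *)
  cexpXZ P X Z Y f0 ->
  (forall x, cexpZ P Z (Yp x) (mu x)) ->
  (* all expectations finite *)
  P.-integrable setT (fun w => ((Y w - f0 (X w) (Z w)) ^+ 2)%:E) ->
  (P \x P)%E.-integrable setT
     (fun w => ((Y w.1 - f0 (X w.2) (Z w.1)) ^+ 2)%:E) ->
  (forall x x', P.-integrable (X @^-1` [set x])
     (fun w => ((mu x (Z w) - mu x' (Z w)) ^+ 2)%:E)) ->
  MVIM P Y X Z f0 =
  \sum_(x < K) \sum_(x' < K | x' != x)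
     pX P X x * pX P X x' * EZgivenX P X Z x (fun z => (mu x z - mu x' z) ^+ 2).
Proof.
move=> mX mZ mYp iYp iY2 pX0 YE ign cpi pi01 [mf0 if0 Yf0] cmu isq isw imu.
have mY : measurable_fun setT Y.
  by rewrite (_ : Y = fun w => Yp (X w) w); [exact: measurable_fun_level|exact/funext].
have iY : P.-integrable setT (EFin \o Y) by exact: integrable_sqr.
have mfZ x : measurable_fun setT (fun w => f0 x (Z w)) by exact: measurableT_comp.
have mmuZ x : measurable_fun setT (fun w => mu x (Z w)).
  by have [mm _ _] := cmu x; exact: measurableT_comp.
have levelE (g : 'I_K -> Om -> R) x (D : set Om) :
    \int[P]_(w in X @^-1` [set x] `&` D) g (X w) w =
    \int[P]_(w in X @^-1` [set x] `&` D) g x w.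
  by apply: eq_Rintegral => w; rewrite inE => -[/= ->].
have levelET (g : 'I_K -> Om -> R) x :
    \int[P]_(w in X @^-1` [set x]) g (X w) w = \int[P]_(w in X @^-1` [set x]) g x w.
  by have := levelE g x setT; rewrite setIT.
have if0x x : P.-integrable (X @^-1` [set x]) (EFin \o (f0 x \o Z)).
  have : P.-integrable (X @^-1` [set x]) (fun w => (f0 (X w) (Z w))%:E).
    exact: integrableS if0.
  by apply: eq_integrable => // w; rewrite inE /= => ->.
have Yf0x x B : measurable B -> \int[P]_(w in X @^-1` [set x] `&` Z @^-1` B) Y w =
    \int[P]_(w in X @^-1` [set x] `&` Z @^-1` B) f0 x (Z w).
  move=> mB; rewrite -(levelE (fun y w => f0 y (Z w))).
  by rewrite /Rintegral Yf0.
have fmu x : {ae P, forall w, f0 x (Z w) = mu x (Z w)}.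
  apply: (@regression_identification _ _ _ P _ _ Z mZ (X @^-1` [set x]) (Yp x)
    (pi x) (mu x) (f0 x)) => //.
  - exact: iYp.
  - by move=> S mS; apply: ign; exact: g_sigma_preimage_coord.
  (* Consistency identifies [Y] with [Yp x] on [{X = x}], where [f0 x] is the regression of [Y]. *)
  - move=> B mB; rewrite -Yf0x// -(levelE Yp).
    by apply: eq_Rintegral => w _; rewrite YE.
pose q x w := (Y w - f0 x (Z w)) ^+ 2.
have q0 x w : 0 <= q x w by exact: sqr_ge0.
have mq x : measurable_fun setT (q x).
  by apply: measurable_funX; exact: measurable_funB.
have iq := integrable_switch mX mq q0 pX0 isw.
have iqD x y : P.-integrable (X @^-1` [set x]) (EFin \o q y).
  by exact: integrableS (iq y).
have origE : e_orig P Y X Z f0 = \sum_x \int[P]_(w in X @^-1` [set x]) q x w.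
  rewrite /e_orig (Rintegral_level mX)//; apply: eq_bigr => x _.
  exact: (levelET q).
(* After the exchange of sums, [x] is the unit's own treatment and [y] the level taken from the
   independent copy. *)
have switchE : e_switch P Y X Z f0 =
    \sum_x \sum_y pX P X y * \int[P]_(w in X @^-1` [set x]) q y w.
  rewrite /e_switch (Rintegral_switch mX q0 iq isw) exchange_big/=.
  by apply: eq_bigr => y _; rewrite (Rintegral_level mX)// mulr_sumr.
rewrite /MVIM switchE origE -sumrB; apply: eq_bigr => x _.
(* Writing 1 as the sum of the [p_y] puts both risks under the same weights, so the diagonal term
   [y = x] vanishes. *)
rewrite -[X in _ - X]mul1r -(sum_pX P mX) mulr_suml -sumrB (bigD1 x)//= subrr add0r.
apply: eq_bigr => y _; rewrite -mulrBr.
have iYx : P.-integrable (X @^-1` [set x]) (EFin \o Y) by exact: integrableS iY.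
rewrite (excess_risk (mX x) mZ (mf0 x) (mf0 y) iYx (if0x x) (Yf0x x)
  (iqD x x) (iqD x y)).
have px : pX P X x != 0 by rewrite gt_eqF.
(* The factor [p_x] of the target cancels the normalisation inside [EZgivenX], leaving an
   unnormalised integral over [{X = x}]. *)
transitivity (pX P X y *
    \int[P]_(w in X @^-1` [set x]) (mu x (Z w) - mu y (Z w)) ^+ 2); last first.
  by rewrite /EZgivenX; field.
congr (_ * _).
apply: eq_ae_Rintegral => //.
- by apply: measurable_funTS; apply: measurable_funX; exact: measurable_funB.
- by apply: measurable_funTS; apply: measurable_funX; exact: measurable_funB.
(* Replacing [f0 y] by [mu y] on [{X = x}] with [y != x] is where equality on the whole space
   matters. *)
by apply: filterS2 (fmu x) (fmu y) => w -> -> _.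
Qed.
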